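(* Let $n\ge 2$, $Q=n+2$ (so $Q\geq 4$) and $0<R\leq\infty$. Let $(V,W)$ be a $Q$-dimensional Bessel pair on $(0,R)$ with positive solution $f$ on $(0,R)$. Then for every radial function $u\in C_c^\infty(B_R(o)\setminus\{o\})$ $$\int_{B_{R}(o)} V(\varrho) \frac{(\mathcal{L}_G u)^{2}}{|\nabla_G \varrho|^{2}}\,dx\,dt =\int_{B_{R}(o)} W(\varrho)|\nabla_G u|^{2}\,dx\,dt +(Q-1) \int_{B_{R}(o)}\left(\frac{V(\varrho)}{\varrho^{2}}-\frac{V_{\varrho}(\varrho)}{\varrho}\right)|\nabla_G u|^2 \,dx\,dt +\int_{B_{R}(o)} V(\varrho)\left|\nabla_{G}\left(\frac{u_\varrho}{f(\varrho)}\right)\right|^{2} f^{2}(\varrho)\,dx\,dt .$$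
   Context: Grushin space: fix an integer $n\ge 2$ and put $Q=n+2$ (homogeneous dimension). Points of $\mathbb{R}^{n+1}$ are written $(x,t)$ with $x\in\mathbb{R}^n$, $t\in\mathbb{R}$; $o$ is the origin; all functions are real-valued. The Grushin gradient is $\nabla_G u=(\nabla_x u,\ |x|\partial_t u)$, so $|\nabla_G u|^2=|\nabla_x u|^2+|x|^2(\partial_t u)^2$. The Grushin operator is $\mathcal{L}_G=\Delta_x+|x|^2\partial_t^2$. The homogeneous norm is $\varrho(x,t)=(|x|^4+4t^2)^{1/4}$; it satisfies $|\nabla_G\varrho|^2=|x|^2/\varrho^2$ away from $o$. For $0<R\le\infty$, $B_R(o)=\{(x,t):\varrho(x,t)<R\}$ (so $B_\infty(o)=\mathbb{R}^{n+1}$). A function is radial if it depends only on $\varrho(x,t)$. A suffix $\varrho$ denotes the derivative with respect to the radial variable: $u_\varrho=\partial_\varrho u=\frac1\varrho\left(\sum_{j=1}^n x_j\partial_{x_j}u+2t\,\partial_t u\right)$, and $V_\varrho=V'$. Bessel pair: a pair $(V,W)$ of $C^1$ functions on $(0,R)$ is a $Q$-dimensional Bessel pair on $(0,R)$ with positive solution $f$ if the ODE $(r^{Q-1}V(r)y')'+r^{Q-1}W(r)y=0$ has the positive solution $y=f$ on $(0,R)$ (in the classical sense). *)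

(* Defs.v *)
From HB Require Import structures.
From mathcomp Require Export all_boot all_order all_algebra.
From mathcomp Require Export all_classical all_reals all_analysis.
Export Order.TTheory GRing.Theory Num.Theory.
Export numFieldNormedType.Exports.

Set Implicit Arguments.
Unset Strict Implicit.
Unset Printing Implicit Defensive.

Local Open Scope ring_scope.
Local Open Scope classical_set_scope.

(* Lebesgue measure on R^n, carried by the n-tuples (the library has no product
   sigma-algebra on row vectors): iterated product of the one-dimensional
   Lebesgue measure, transported along (v, a) |-> a :: v. *)
Section LebesgueTuple.
Context (R : realType).
Local Notation T := (measurableTypeR R).

Definition tuple_cons n (p : n.-tuple T * T) : n.+1.-tuple T :=
  [the n.+1.-tuple T of p.2 :: p.1].

Lemma measurable_tuple_cons n : measurable_fun setT (@tuple_cons n).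
Proof. exact: measurable_cons. Qed.

Definition lebesgue_tupleS n (mu : {measure set (n.-tuple T) -> \bar R}) :=
  pushforward (mu \x @lebesgue_measure R)%E (@tuple_cons n).

HB.instance Definition _ n (mu : {measure set (n.-tuple T) -> \bar R}) :=
  Measure.copy (lebesgue_tupleS mu)
    (@measure_function_pushforward__canonical__measure_function_Measure
      _ _ _ _ _ (mu \x @lebesgue_measure R)%E _ (@measurable_tuple_cons n)).

Fixpoint lebesgue_tuple n : {measure set (n.-tuple T) -> \bar R} :=
  match n with
  | 0 => \d_([tuple] : 0.-tuple T)
  | m.+1 => lebesgue_tupleS (lebesgue_tuple m)
  end.

End LebesgueTuple.

Section Grushin.
Context (R : realType) (n : nat).
Implicit Types (p : 'rV[R]_n * R) (u : 'rV[R]_n * R -> R) (rad : \bar R).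

Definition of_tuple (q : n.-tuple (measurableTypeR R) * measurableTypeR R) :
  'rV[R]_n * R := (\row_i tnth q.1 i, q.2).

Definition lebesgue_int (A : set ('rV[R]_n * R)) (F : 'rV[R]_n * R -> R) :
    \bar R :=
  \int[(lebesgue_tuple R n \x @lebesgue_measure R)%E]_(q in of_tuple @^-1` A)
    (F (of_tuple q))%:E.

(* The library norm on row vectors and on pairs is the sup norm. *)
Definition euclid (x : 'rV[R]_n) : R := Num.sqrt (\sum_i x 0 i ^+ 2).

Definition sqnorm p : R := \sum_i p.1 0 i ^+ 2 + p.2 ^+ 2.

Definition dx (i : 'I_n) u p : R := 'D_((delta_mx 0 i, 0) : 'rV[R]_n * R) u p.

Definition dt u p : R := 'D_((0, 1) : 'rV[R]_n * R) u p.

Definition gradG u p : 'rV[R]_n * R := (\row_i dx i u p, euclid p.1 * dt u p).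

Definition opG u p : R :=
  \sum_i dx i (dx i u) p + euclid p.1 ^+ 2 * dt (dt u) p.

Definition rho p : R := (euclid p.1 ^+ 4 + 4 * p.2 ^+ 2) `^ 4^-1.

Definition drho u p : R :=
  (\sum_i p.1 0 i * dx i u p + 2 * p.2 * dt u p) / rho p.

Definition ballG rad : set ('rV[R]_n * R) := [set p | ((rho p)%:E < rad)%E].

Definition radial u := exists g : R -> R, forall p, u p = g (rho p).

End Grushin.

Arguments lebesgue_int {R n} A F.
Arguments rho {R n} p.
Arguments ballG {R n} rad.

(* In finite dimension this is the usual C^k: f is differentiable and all its
   directional derivatives are C^(k-1). *)
Fixpoint Ck (R : realType) (E : normedModType R) (k : nat) (f : E -> R) : Prop :=
  match k with
  | 0 => continuous f
  | k'.+1 => (forall x, differentiable f x) /\ forall v, Ck k' ('D_v f)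
  end.

Definition smooth (R : realType) (E : normedModType R) (f : E -> R) : Prop :=
  forall k, Ck k f.

(* Elements of C_c^oo(A), A open, are identified with their extensions by 0 to
   the whole space. *)
Definition test_function (R : realType) (E : normedModType R) (A : set E)
    (f : E -> R) : Prop :=
  [/\ smooth f, compact (closure [set x | f x != 0])
    & closure [set x | f x != 0] `<=` A].

Section Bessel.
Context (R : realType).
Implicit Types (rad : \bar R) (g V W f : R -> R).

Definition interval0 rad : set R := [set r | 0 < r /\ (r%:E < rad)%E].

Definition C1_on (A : set R) g : Prop :=
  forall r, A r -> derivable g r 1 /\ {for r, continuous (derive1 g)}.

(* A classical solution of the divergence-form equation: f is C^1 and the flux
   r^(Q-1) V f' is differentiable; f need not be C^2 where V vanishes. *)
Definition bessel_pair (Q : nat) rad V W f : Prop :=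
  let flux r := r ^+ Q.-1 * V r * derive1 f r in
  [/\ C1_on (interval0 rad) V, C1_on (interval0 rad) W,
      C1_on (interval0 rad) f, (forall r, interval0 rad r -> 0 < f r)
    & forall r, interval0 rad r ->
        derivable flux r 1 /\ derive1 flux r + r ^+ Q.-1 * W r * f r = 0].

End Bessel.

(* Main.v *)
From HB Require Import structures.
Require Import Defs.
From mathcomp Require Import measurable_realfun ring lra.

(* Put N(x,t) = |x|^4 + 4 t^2 = rho^4 and S = |x|^2.  A radial test function is
   u = phi o N with phi in C^2, and with psi = phi' every integrand of the
   identity has the form S * h(N) with h continuous and compactly supported in
   (0, R^4).  The Bessel equation turns the difference of the two sides into
   S * (4 N K'(N) + (Q + 2) K(N)), where
   K(r^4) = 16 r^2 psi(r^4)^2 (r V f'/f + (Q - 1) V), and this is the Euclidean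
   divergence of the C^1 compactly supported field K(N) S (x, 2t).  By Fubini
   and the fundamental theorem of calculus on each coordinate line its integral
   vanishes, so no polar coordinates are needed. *)

Set Implicit Arguments.
Unset Strict Implicit.
Unset Printing Implicit Defensive.

Local Open Scope ring_scope.
Local Open Scope classical_set_scope.

(** * Calculus on lines *)

(** The field (x, 2t) generates the dilations (λx, λ²t), for which N has degree 4, S degree 2 and
    Lebesgue measure degree Q: hence the coefficients 4 and Q + 2. In polar form S dx dt carries
    r^(Q+1) dr, and r^(Q+1) (4 N K' + (Q + 2) K) is the derivative of r^(Q+2) K(r^4), so K is the
    boundary term of the one-dimensional integration by parts divided by r^(Q+2). Two obstacles
    shape the argument. The solution f is only C^1, so f'' must never occur: f' enters K only
    through r V f', whose derivative the Bessel equation supplies as a continuous function, and this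
    makes K of class C^1. The quotient by |∇_G ρ|² = S/ρ² degenerates on the axis x = 0; for radial
    u, however, L_G u has a factor S, and the square absorbs the denominator. Since N is a
    polynomial, the chain rule for functions of N holds at every point, the origin included. Outside
    (0, R) nothing is known about V, W and f; there psi and its derivative vanish. *)

Section Calculus.
Context (R : realType).

(** Both difference quotients are the same function of [h]. This gives access to the one-variable
    chain rule without total differentiability of [F]. *)
Lemma is_derive_lineP (E : normedModType R) (F : E -> R) (x v : E) (d : R) :
  is_derive x v F d <-> is_derive (0 : R) 1 (fun h : R => F (h *: v + x)) d.
Proof.
have E1 : 'D_1 (fun h : R => F (h *: v + x)) 0 = 'D_v F x.
  rewrite /derive; set g1 := fun h => h^-1 *: _; set g2 := fun h => h^-1 *: _.
  suff -> : g1 = g2 by [].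
  apply/funext => h; rewrite /g1 /g2 /=.
  by rewrite addr0 scale0r add0r [h *: 1]mulr1.
split=> -[dF <-].
  by apply: DeriveDef; [exact: (derivable1P F x v).1 dF|exact: E1].
by apply: DeriveDef; [exact: (derivable1P F x v).2 dF|rewrite -E1].
Qed.

Lemma is_derive_comp (E : normedModType R) (g : E -> R) (F : R -> R)
    (x v : E) (dg dF : R) :
  is_derive x v g dg -> is_derive (g x) 1 F dF ->
  is_derive x v (fun y => F (g y)) (dF * dg).
Proof.
move=> /is_derive_lineP g' F'; apply/is_derive_lineP.
apply: (@is_derive1_comp _ F (fun h : R => g (h *: v + x))).
by rewrite scale0r add0r.
Qed.

Lemma is_derive_congr (E : normedModType R) (F G : E -> R) (x v : E) (d e : R) :
  is_derive x v F d -> (forall y, F y = G y) -> d = e -> is_derive x v G e.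
Proof. by move=> + /funext <- <-. Qed.

Lemma is_derive_near (E : normedModType R) (F G : E -> R) (A : set E)
    (x v : E) (d : R) :
  is_derive x v F d -> nbhs x A -> (forall y, A y -> F y = G y) ->
  is_derive x v G d.
Proof.
move=> F' xA FG; apply: (near_eq_is_derive _ F').
by apply: filterS xA => y; exact: FG.
Qed.

Lemma is_derive_continuous (F : R -> R) (x d : R) :
  is_derive x 1 F d -> {for x, continuous F}.
Proof.
by move=> [F' _]; apply: differentiable_continuous; exact/derivable1_diffP.
Qed.

Lemma continuous_near (F G : R -> R) (x : R) (A : set R) :
  {for x, continuous F} -> nbhs x A -> (forall y, A y -> F y = G y) ->
  {for x, continuous G}.
Proof.
move=> cF xA FG; rewrite /prop_for /continuous_at -(FG x (nbhs_singleton xA)).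
apply: cvg_trans cF; apply: near_eq_cvg.
by apply: filterS xA => y; exact: FG.
Qed.

Lemma nbhs_itv_complement (a b x : R) : ~ (a <= x <= b) ->
  nbhs x [set y | ~ (a <= y <= b)].
Proof.
move=> /negP; rewrite negb_and -!ltNge => /orP[xa|bx].
  apply: filterS (lt_nbhsl xa) => y /= ya.
  by apply/negP; rewrite negb_and -!ltNge ya.
apply: filterS (lt_nbhsr bx) => y /= ya.
by apply/negP; rewrite negb_and -!ltNge ya orbT.
Qed.

Lemma continuous_compact_support (h : R -> R) (a b : R) :
  (forall x, a <= x <= b -> {for x, continuous h}) ->
  (forall x, ~ (a <= x <= b) -> h x = 0) -> continuous h.
Proof.
move=> hin hout x; have [xab|xab] := pselect (a <= x <= b); first exact: hin.
apply: (@continuous_near (cst 0) h x _ _ (nbhs_itv_complement xab)).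
  exact: cst_continuous.
by move=> y /hout.
Qed.

Lemma compact_support_bounded (h : R -> R) (a b : R) :
  continuous h -> (forall x, ~ (a <= x <= b) -> h x = 0) ->
  exists2 M, 0 <= M & forall x, `|h x| <= M.
Proof.
move=> ch h0.
have cn : continuous (fun x => `|h x|).
  by move=> x; apply: cvg_norm; exact: ch.
have [ab|ba] := leP a b; last first.
  exists 0 => // x; rewrite h0 ?normr0// => /andP[ax xb].
  by move: (le_trans ax xb); rewrite leNgt ba.
have [c _ hc] := EVT_max ab (continuous_subspaceT cn).
exists `|h c| => // x; have [xab|xab] := pselect (a <= x <= b).
  by apply: hc; rewrite in_itv.
by rewrite h0// normr0.
Qed.

Lemma integral_derivative_eq0 (F F' : R -> R) (M : R) : 0 < M ->
  (forall s : R, is_derive s 1 F (F' s)) -> continuous F' ->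
  (forall s, M < `|s| -> F s = 0) ->
  (\int[@lebesgue_measure R]_s (F' s)%:E = 0)%E.
Proof.
move=> M0 dF cF' F0.
have F'0 s : M < `|s| -> F' s = 0.
  move=> Ms; have := dF s => -[_ <-].
  have nM : nbhs s [set y | M < `|y|].
    have : nbhs `|s| [set y | M < y] by exact: lt_nbhsr.
    exact: (@cvg_norm _ _ _ (nbhs s) _ id s cvg_id).
  suff : is_derive s 1 F 0 by move=> [].
  by apply: (is_derive_near (is_derive_cst 0 _ _) nM) => y /F0.
(* [F] is known to vanish only strictly beyond [M], so the endpoints are moved outward by 1. *)
pose a : R := M + 1.
have aM : M < a by rewrite /a ltrDl.
have a0 : 0 < a := lt_trans M0 aM.
transitivity (\int[@lebesgue_measure R]_(s in `[(- a)%R, a]) (F' s)%:E)%E.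
  rewrite [RHS]integral_mkcond; apply: eq_integral => s _.
  rewrite patchE; case: ifPn => // /negP sa; rewrite F'0//.
  rewrite ltNge; apply/negP => sM; apply: sa.
  by rewrite inE/= in_itv/= -ler_norml (le_trans sM)// ltW.
have cF : continuous F by move=> s; exact: is_derive_continuous (dF s).
rewrite (@continuous_FTC2 _ F' F).
- by rewrite !F0 ?subee ?normrN ?ger0_norm// ltW.
- by lra.
- exact: continuous_subspaceT.
- split=> [s _||]; first by have [] := dF s.
    exact/cvg_at_right_filter/cF.
  exact/cvg_at_left_filter/cF.
- by move=> s _; rewrite derive1E; have [] := dF s.
Qed.

End Calculus.

(** * Fubini on coordinate lines of tuples *)

Section MeasureGeneral.
Context (R : realType).

Lemma integrable_bounded_support d (T : measurableType d)
    (mu : {measure set T -> \bar R}) (F : T -> R) (A : set T) (M : R) :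
  measurable A -> (mu A < +oo)%E -> measurable_fun setT F ->
  (forall x, `|F x| <= M) -> (forall x, ~ A x -> F x = 0) ->
  mu.-integrable setT (EFin \o F).
Proof.
move=> mA Afin mF FM F0.
have -> : EFin \o F = (EFin \o F) \_ A.
  apply/funext => x; rewrite patchE; case: ifPn => //= /negP xA.
  by rewrite F0//; apply: contra_not xA => ?; rewrite inE.
apply/(integrable_mkcond _ mA); apply: measurable_bounded_integrable => //.
  exact: measurable_funTS.
by exists M; split; [exact: num_real|move=> x /= Mx y _; exact: le_trans (ltW Mx)].
Qed.

Section Fubini0.
Context d1 d2 (T1 : measurableType d1) (T2 : measurableType d2).
Variables (m1 : {measure set T1 -> \bar R}).
Variables (m2 : {sigma_finite_measure set T2 -> \bar R}).
Hypothesis sm1 : sigma_finite setT m1.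
Variable F : T1 * T2 -> \bar R.
Hypothesis intF : (m1 \x m2)%E.-integrable setT F.

(** [lebesgue_tuple] is defined by recursion as a bare measure, and its σ-finiteness is a separate
    proposition. Fubini expects it as a structure, which is packed here from [sm1]. *)
Let m1' : {sigma_finite_measure set T1 -> \bar R} :=
  HB.pack_for (SigmaFiniteMeasure.type T1 R) (Measure.sort m1)
    (isSFinite.Build _ T1 R m1 (sfinite_measure_sigma_finite sm1))
    (isSigmaFinite.Build _ T1 R m1 sm1).

Lemma integral_prod_eq0l :
  (forall x, \int[m2]_y F (x, y) = 0)%E -> (\int[(m1 \x m2)%E]_z F z = 0)%E.
Proof.
move=> F0; have := @integral12_prod_meas1 _ _ _ _ _ m1' m2 F intF.
by move=> <-; apply: integral0_eq => x _; exact: F0.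
Qed.

Lemma integral_prod_eq0r :
  (forall y, \int[m1]_x F (x, y) = 0)%E -> (\int[(m1 \x m2)%E]_z F z = 0)%E.
Proof.
move=> F0; have := @integral21_prod_meas1 _ _ _ _ _ m1' m2 F intF.
by move=> <-; apply: integral0_eq => x _; exact: F0.
Qed.

End Fubini0.

End MeasureGeneral.

Section Tuples.
Context (R : realType).
Local Notation T := (measurableTypeR R).

Definition box n (M : R) : set (n.-tuple T) :=
  [set v | forall i, `|tnth v i| <= M].

Definition upd n (v : n.-tuple T) (i : 'I_n) (s : R) : n.-tuple T :=
  [tuple if j == i then (s : T) else tnth v j | j < n].

Lemma tnth_upd n (v : n.-tuple T) i s j :
  tnth (upd v i s) j = if j == i then s else tnth v j.
Proof. by rewrite tnth_mktuple. Qed.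

Lemma tnth_tuple_cons0 n (w : n.-tuple T) (a : T) :
  tnth (tuple_cons (w, a)) ord0 = a.
Proof. by []. Qed.

Lemma tnth_tuple_consS n (w : n.-tuple T) (a : T) i :
  tnth (tuple_cons (w, a)) (lift ord0 i) = tnth w i.
Proof. by rewrite tnthS. Qed.

Lemma upd_tuple_cons0 n (w : n.-tuple T) (a : T) s :
  upd (tuple_cons (w, a)) ord0 s = tuple_cons (w, s).
Proof.
apply: eq_from_tnth => j; rewrite tnth_upd.
by case: (unliftP ord0 j) => [j' ->|-> //]; rewrite !tnth_tuple_consS.
Qed.

Lemma upd_tuple_consS n (w : n.-tuple T) (a : T) i s :
  upd (tuple_cons (w, a)) (lift ord0 i) s = tuple_cons (upd w i s, a).
Proof.
apply: eq_from_tnth => j; rewrite tnth_upd.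
case: (unliftP ord0 j) => [j' ->|-> //].
by rewrite !tnth_tuple_consS tnth_upd (inj_eq lift_inj).
Qed.

Lemma measurable_box n (M : R) : measurable (@box n M).
Proof.
have -> : @box n M = \big[setI/setT]_(i < n) (@tnth n T ^~ i @^-1` `[- M, M]).
  rewrite -bigcap_seq; apply/seteqP; split=> v /= hv i.
    by move=> _; rewrite /= in_itv/= -ler_norml.
  by have := hv i (mem_index_enum i); rewrite /= in_itv/= -ler_norml.
apply: bigsetI_measurable => i _; rewrite -[X in measurable X]setTI.
exact: measurable_tnth.
Qed.

Lemma tuple_cons_box n (M : R) :
  @tuple_cons R n @^-1` box M = box M `*` `[- M, M].
Proof.
apply/seteqP; split=> -[w a] /=.
  move=> h; split=> [i|]; first by have := h (lift ord0 i); rewrite tnth_tuple_consS.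
  by have := h ord0; rewrite tnth_tuple_cons0 in_itv/= ler_norml.
move=> [hw ha] i; case: (unliftP ord0 i) => [j ->|->].
  by rewrite tnth_tuple_consS.
by move: ha; rewrite tnth_tuple_cons0 in_itv/= ler_norml.
Qed.

Lemma lebesgue_box_lty n (M : R) : (lebesgue_tuple R n (box M) < +oo)%E.
Proof.
elim: n => [|n IH].
  by rewrite /= /dirac indicE ltry.
change (((lebesgue_tuple R n \x @lebesgue_measure R)%E
  (@tuple_cons R n @^-1` box M) < +oo)%E).
rewrite tuple_cons_box product_measure1E//; last exact: measurable_box.
apply: lte_mul_pinfty => //.
  by rewrite ge0_fin_numE.
have : (@lebesgue_measure R `[(- M)%R, M] < +oo)%E.
  by rewrite lebesgue_measure_itv/=; case: ifP => // _; rewrite -EFinD ltry.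
by [].
Qed.

Lemma sigma_finite_lebesgue_tuple n : sigma_finite setT (lebesgue_tuple R n).
Proof.
exists (fun k => box k%:R); last first.
  by move=> k; split; [exact: measurable_box|exact: lebesgue_box_lty].
apply/seteqP; split=> // v _.
have [k kP] : exists k : nat, forall i, `|tnth v i| <= k%:R.
  exists (\max_(i < n) Num.bound `|tnth v i|) => i.
  apply: (@le_trans _ _ (Num.bound `|tnth v i|)%:R).
    by apply: ltW; exact: archi_boundP.
  by rewrite ler_nat (leq_bigmax i).
by exists k.
Qed.

(** A class of integrable functions that is inherited by every slice ([box_bounded_cons]), whereas
    integrability alone passes only to almost every slice. One constant serves as bound and as
    half-side of the box. *)
Definition box_bounded n (F : n.-tuple T -> R) : Prop :=
  measurable_fun setT F /\
  exists M : R, forall v, `|F v| <= M /\ (~ box M v -> F v = 0).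

Lemma box_bounded_integrable n (F : n.-tuple T -> R) :
  box_bounded F -> (lebesgue_tuple R n).-integrable setT (EFin \o F).
Proof.
move=> [mF [M FM]]; apply: (integrable_bounded_support (@measurable_box n M)).
- exact: lebesgue_box_lty.
- by [].
- by move=> x; exact: (FM x).1.
- by move=> x; exact: (FM x).2.
Qed.

Lemma box_bounded_cons_integrable n (F : n.+1.-tuple T -> R) : box_bounded F ->
  (lebesgue_tuple R n \x @lebesgue_measure R)%E.-integrable setT
    (EFin \o (F \o @tuple_cons R n)).
Proof.
move=> [mF [M FM]].
apply: (@integrable_bounded_support _ _ _ _ _ (@tuple_cons R n @^-1` box M) M).
- by rewrite tuple_cons_box; apply: measurableX => //; exact: measurable_box.
- exact: (lebesgue_box_lty n.+1 M).
- by apply: measurableT_comp => //; exact: measurable_tuple_cons.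
- by move=> x; exact: (FM _).1.
- by move=> x; exact: (FM _).2.
Qed.

Lemma integral_lebesgue_tupleS n (F : n.+1.-tuple T -> R) : box_bounded F ->
  (\int[lebesgue_tuple R n.+1]_v (F v)%:E =
   \int[(lebesgue_tuple R n \x @lebesgue_measure R)%E]_q
     (F (tuple_cons q))%:E)%E.
Proof.
move=> bF; rewrite (@integral_pushforward _ _ _ _ _ _ (@measurable_tuple_cons R n)
  (lebesgue_tuple R n \x @lebesgue_measure R)%E setT (EFin \o F))//.
  by apply/measurable_EFinP; exact: bF.1.
exact: box_bounded_cons_integrable.
Qed.

Lemma box_bounded_cons n (F : n.+1.-tuple T -> R) (a : T) :
  box_bounded F -> box_bounded (fun w : n.-tuple T => F (tuple_cons (w, a))).
Proof.
move=> [mF [M FM]]; split.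
  apply: measurableT_comp => //; apply: measurableT_comp => //.
  exact: measurable_tuple_cons.
exists M => w; split; first exact: (FM _).1.
move=> wM; apply: (FM _).2; apply: contra_not wM => h i.
by have := h (lift ord0 i); rewrite tnth_tuple_consS.
Qed.

(** Fubini with the chosen coordinate integrated first. If it is the head, the inner integral is
    zero for every tail; otherwise the head is frozen and the induction hypothesis applies to the
    slice. *)
Lemma integral_upd_eq0 n (F : n.-tuple T -> R) (i : 'I_n) : box_bounded F ->
  (forall v, \int[@lebesgue_measure R]_s (F (upd v i s))%:E = 0)%E ->
  (\int[lebesgue_tuple R n]_v (F v)%:E = 0)%E.
Proof.
elim: n => [|n IH] in F i *; first by case: i.
move=> bF F0; rewrite integral_lebesgue_tupleS//.
have intF := box_bounded_cons_integrable bF.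
have sf := sigma_finite_lebesgue_tuple n.
case: (unliftP ord0 i) F0 => [j ->|->] F0.
  apply: (integral_prod_eq0r sf intF) => a /=.
  apply: (IH (fun w => F (tuple_cons (w, a))) j); first exact: box_bounded_cons.
  move=> w; rewrite -[RHS](F0 (tuple_cons (w, a))).
  by apply: eq_integral => s _; rewrite upd_tuple_consS.
apply: (integral_prod_eq0l sf intF) => w /=.
(* The head 0 is arbitrary: [upd] overwrites it. *)
rewrite -[RHS](F0 (tuple_cons (w, 0))).
by apply: eq_integral => s _; rewrite upd_tuple_cons0.
Qed.

Lemma box_boundedD n (F G : n.-tuple T -> R) :
  box_bounded F -> box_bounded G -> box_bounded (fun v => F v + G v).
Proof.
move=> [mF [M FM]] [mG [M' GM]]; split; first exact: measurable_funD.
exists (`|M| + `|M'|) => v; split.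
  apply: le_trans (ler_normD _ _) _; apply: lerD.
    by apply: le_trans (ler_norm _); exact: (FM v).1.
  by apply: le_trans (ler_norm _); exact: (GM v).1.
move=> h; rewrite (FM v).2 ?(GM v).2 ?addr0//.
  apply: contra_not h => h i; apply: (le_trans (h i)).
  by rewrite (le_trans (ler_norm _))// lerDr.
apply: contra_not h => h i; apply: (le_trans (h i)).
by rewrite (le_trans (ler_norm _))// lerDl.
Qed.

Lemma integral_box_boundedD n (F G : n.-tuple T -> R) :
  box_bounded F -> box_bounded G ->
  (\int[lebesgue_tuple R n]_v (F v + G v)%:E =
   \int[lebesgue_tuple R n]_v (F v)%:E + \int[lebesgue_tuple R n]_v (G v)%:E)%E.
Proof.
move=> bF bG; rewrite -(@integralD_EFin _ _ _ _ _ measurableT F G)//.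
  exact: box_bounded_integrable.
exact: box_bounded_integrable.
Qed.

Lemma integral_box_boundedZ n (k : R) (F : n.-tuple T -> R) : box_bounded F ->
  (\int[lebesgue_tuple R n]_v (k * F v)%:E =
   k%:E * \int[lebesgue_tuple R n]_v (F v)%:E)%E.
Proof.
move=> bF; rewrite -(integralZl measurableT)//.
exact: box_bounded_integrable.
Qed.

Lemma box_boundedZ n (k : R) (F : n.-tuple T -> R) :
  box_bounded F -> box_bounded (fun v => k * F v).
Proof.
move=> [mF [M FM]]; split; first exact: measurable_funM.
exists (`|k * M| + `|M|) => v; split.
  rewrite (@le_trans _ _ `|k * M|)// ?lerDl// !normrM ler_wpM2l//.
  by apply: le_trans (ler_norm _); exact: (FM v).1.
move=> h; rewrite (FM v).2 ?mulr0//; apply: contra_not h => h i.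
by apply: (le_trans (h i)); rewrite (le_trans (ler_norm _))// lerDr.
Qed.

End Tuples.

(** * The Grushin operators on functions of the gauge *)

Section Coordinates.
Context (R : realType) (n : nat).
Implicit Types (p q v : 'rV[R]_n * R) (u : 'rV[R]_n * R -> R).

(** The S of the overview; [gauge] below is N. Both are polynomials, hence differentiable
    everywhere, unlike [euclid] on the axis x = 0 and [rho] at the origin. *)
Definition horiz p : R := \sum_i p.1 0 i ^+ 2.

Definition gauge p : R := horiz p ^+ 2 + 4 * p.2 ^+ 2.

Definition ex (i : 'I_n) : 'rV[R]_n * R := (delta_mx 0 i, 0).

Definition et : 'rV[R]_n * R := (0, 1).

Lemma horiz_ge0 p : 0 <= horiz p.
Proof. by apply: sumr_ge0 => i _; rewrite sqr_ge0. Qed.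

Lemma gauge_ge0 p : 0 <= gauge p.
Proof. by rewrite addr_ge0 ?sqr_ge0// mulr_ge0// sqr_ge0. Qed.

Lemma euclid_sqr p : euclid p.1 ^+ 2 = horiz p.
Proof. by rewrite sqr_sqrtr// horiz_ge0. Qed.

Lemma gauge_eq0 p : gauge p = 0 -> p = 0.
Proof.
have t2 : 0 <= 4 * p.2 ^+ 2 by rewrite mulr_ge0 ?sqr_ge0.
move=> /eqP; rewrite paddr_eq0 ?sqr_ge0//.
rewrite sqrf_eq0 mulf_eq0 pnatr_eq0 sqrf_eq0/= => /andP[/eqP S0 /eqP t0].
case: p {t2} S0 t0 => x t /= S0 ->; congr pair; apply/rowP => i; rewrite mxE.
move/eqP: S0; rewrite psumr_eq0; last by move=> j _; rewrite sqr_ge0.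
by move=> /allP /(_ i (mem_index_enum i)) /=; rewrite sqrf_eq0 => /eqP.
Qed.

Lemma gauge0 : gauge 0 = 0.
Proof.
by rewrite /gauge/= /horiz big1 ?expr0n/= ?mulr0 ?addr0// => i _; rewrite mxE expr0n.
Qed.

(** The radius as a function of N. Iterated square roots give a total function, continuous on the
    whole line and 0 for [y <= 0]. *)
Definition root4 (y : R) : R := Num.sqrt (Num.sqrt y).

Lemma root4_gt0 y : (0 < root4 y) = (0 < y).
Proof. by rewrite !sqrtr_gt0. Qed.

Lemma root4K y : 0 <= y -> root4 y ^+ 4 = y.
Proof.
by move=> y0; rewrite -[4%N]/(2 * 2)%N exprM !sqr_sqrtr// sqrtr_ge0.
Qed.

Lemma rho_gauge p : rho p = root4 (gauge p).
Proof.
rewrite /rho -[4%N]/(2 * 2)%N exprM euclid_sqr -/(gauge p).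
have -> : (4^-1 : R) = 2^-1 * 2^-1 by lra.
by rewrite powRrM !powR12_sqrt ?sqrtr_ge0// ?gauge_ge0.
Qed.

Lemma is_derive_coord p v j : is_derive p v (fun q => q.1 0 j) (v.1 0 j).
Proof.
apply/is_derive_lineP.
have D := @is_deriveD R R R (fun h : R => v.1 0 j *: h) (cst (p.1 0 j)) 0 1 _ _
  (is_deriveZ (v.1 0 j) (is_derive_id (0 : R) (1 : R)))
  (is_derive_cst (p.1 0 j) (0 : R) (1 : R)).
apply: (is_derive_congr D) => [h|].
  by rewrite /= !mxE mulrC.
by rewrite addr0 [_ *: _]mulr1.
Qed.

Lemma is_derive_last p v : is_derive p v (fun q => q.2) v.2.
Proof.
apply/is_derive_lineP.
have D := @is_deriveD R R R (fun h : R => v.2 *: h) (cst p.2) 0 1 _ _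
  (is_deriveZ v.2 (is_derive_id (0 : R) (1 : R)))
  (is_derive_cst p.2 (0 : R) (1 : R)).
apply: (is_derive_congr D) => [h|].
  by rewrite /= [h *: _]mulrC.
by rewrite addr0 [_ *: _]mulr1.
Qed.

Lemma is_derive_horiz p v :
  is_derive p v horiz (2 * \sum_i p.1 0 i * v.1 0 i).
Proof.
have D := @is_derive_sum R _ _ n (fun i q => q.1 0 i ^+ 2) p v
  (fun i => 2 * (p.1 0 i * v.1 0 i)).
rewrite mulr_sumr; apply: (is_derive_congr (D _)) => // [i|q].
  apply: (is_derive_congr (is_deriveX 2 (is_derive_coord p v i))) => //.
  by rewrite /= [_ *: _]mulrC; ring.
by rewrite /horiz fct_sumE.
Qed.

Lemma is_derive_gauge p v : is_derive p v gauge
  (4 * horiz p * (\sum_i p.1 0 i * v.1 0 i) + 8 * p.2 * v.2).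
Proof.
have D1 := is_deriveX 2 (is_derive_horiz p v).
have D2 := is_deriveZ 4 (is_deriveX 2 (is_derive_last p v)).
apply: (is_derive_congr (is_deriveD D1 D2)) => // /=.
by rewrite /GRing.scale/=; ring.
Qed.

Lemma sum_ex p i : \sum_j p.1 0 j * (ex i).1 0 j = p.1 0 i.
Proof.
rewrite (bigD1 i)//= mxE !eqxx mulr1 big1 ?addr0// => j ji.
by rewrite mxE eqxx (negbTE ji) mulr0.
Qed.

Lemma sum_et p : \sum_j p.1 0 j * et.1 0 j = 0.
Proof. by rewrite big1// => j _; rewrite mxE mulr0. Qed.

Lemma is_derive_gauge_ex p i :
  is_derive p (ex i) gauge (4 * horiz p * p.1 0 i).
Proof.
by apply: (is_derive_congr (is_derive_gauge _ _)) => //; rewrite sum_ex mulr0 addr0.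
Qed.

Lemma is_derive_gauge_et p : is_derive p et gauge (8 * p.2).
Proof.
apply: (is_derive_congr (is_derive_gauge _ _)) => //.
by rewrite sum_et mulr0 add0r mulr1.
Qed.

Lemma is_derive_horiz_ex p i : is_derive p (ex i) horiz (2 * p.1 0 i).
Proof.
by apply: (is_derive_congr (is_derive_horiz _ _)) => //; rewrite sum_ex.
Qed.

Lemma is_derive_horiz_et p : is_derive p et horiz 0.
Proof.
by apply: (is_derive_congr (is_derive_horiz _ _)) => //; rewrite sum_et mulr0.
Qed.

Lemma is_derive_comp_gauge_ex (phi : R -> R) p i (d : R) : is_derive (gauge p) 1 phi d ->
  is_derive p (ex i) (fun q => phi (gauge q)) (4 * d * horiz p * p.1 0 i).
Proof.
move=> D; apply: (is_derive_congr (is_derive_comp (is_derive_gauge_ex p i) D)) => //.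
by ring.
Qed.

Lemma is_derive_comp_gauge_et (phi : R -> R) p (d : R) : is_derive (gauge p) 1 phi d ->
  is_derive p et (fun q => phi (gauge q)) (8 * d * p.2).
Proof.
move=> D; apply: (is_derive_congr (is_derive_comp (is_derive_gauge_et p) D)) => //.
by ring.
Qed.

Lemma is_derive_root4 (y : R) : 0 < y -> is_derive y 1 root4 (4 * root4 y ^+ 3)^-1.
Proof.
move=> y0; have s0 : 0 < Num.sqrt y by rewrite sqrtr_gt0.
apply: (is_derive_congr (is_derive_comp (is_derive1_sqrt y0) (is_derive1_sqrt s0))) => //.
have r0 : 0 < root4 y by rewrite root4_gt0.
have -> : Num.sqrt y = root4 y ^+ 2 by rewrite sqr_sqrtr// ltW.
rewrite -/(root4 y) sqrtr_sqr ger0_norm ?(ltW r0)//.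
by field; rewrite gt_eqF.
Qed.

(** The x-part contributes 16 d² S³ and the weighted t-part 64 d² S t²; the sum factors through N =
    S² + 4t². Only derivatives at [p] are assumed, so the lemma serves [u], [rho] and the quotient
    u_ρ / f alike. *)
Lemma sqnorm_gradG u p (d : R) :
  (forall i, is_derive p (ex i) u (4 * d * horiz p * p.1 0 i)) ->
  is_derive p et u (8 * d * p.2) ->
  sqnorm (gradG u p) = 16 * d ^+ 2 * horiz p * gauge p.
Proof.
move=> Dx Dt; rewrite /sqnorm /gradG /=.
rewrite exprMn euclid_sqr /dt (@derive_val _ _ _ _ _ _ _ Dt).
under eq_bigr => i _.
  rewrite mxE /dx (@derive_val _ _ _ _ _ _ _ (Dx i)) exprMn.
  over.
by rewrite -mulr_sumr -/(horiz p) /gauge; ring.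
Qed.

(** Euler's identity: N has degree 4 under the dilations, so their generator maps it to 4 N, and 4 N
    / ρ = 4 ρ³. *)
Lemma drho_comp_gauge u (phi : R -> R) p (d : R) : (forall q, u q = phi (gauge q)) ->
  is_derive (gauge p) 1 phi d -> drho u p = 4 * root4 (gauge p) ^+ 3 * d.
Proof.
move=> /funext -> D; rewrite /drho rho_gauge.
rewrite /dt (@derive_val _ _ _ _ _ _ _ (is_derive_comp_gauge_et D)).
under eq_bigr => i _.
  rewrite /dx (@derive_val _ _ _ _ _ _ _ (is_derive_comp_gauge_ex i D)).
  rewrite mulrCA -expr2; over.
rewrite -mulr_sumr -/(horiz p).
(* At the origin both sides are 0, the left one by the convention [0^-1 = 0]. *)
have [g0|g0] := eqVneq (gauge p) 0.
  have -> : root4 (gauge p) = 0 by rewrite g0 /root4 !sqrtr0.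
  by rewrite invr0 expr0n/= !mulr0 mul0r.
have r0 : root4 (gauge p) != 0.
  by rewrite gt_eqF// root4_gt0 lt_neqAle eq_sym g0 gauge_ge0.
have -> : 4 * d * horiz p * horiz p + 2 * p.2 * (8 * d * p.2)
  = 4 * d * gauge p by rewrite /gauge; ring.
by rewrite -{1}(root4K (gauge_ge0 p)); field.
Qed.

(** L_G(φ(N)) = φ''(N) |∇_G N|² + φ'(N) L_G N, where |∇_G N|² = 16 S N and L_G N = 4 (n + 2) S + 8
    S. Both terms carry the factor S that later cancels the denominator |∇_G ρ|². *)
Lemma opG_comp_gauge u (phi psi : R -> R) (theta : R) p : (forall q, u q = phi (gauge q)) ->
  (forall y : R, is_derive y 1 phi (psi y)) ->
  is_derive (gauge p) 1 psi theta ->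
  opG u p = horiz p * (16 * gauge p * theta + 4 * (n%:R + 4) * psi (gauge p)).
Proof.
move=> /funext -> Dphi Dpsi; rewrite /opG.
have dtE : dt (fun q => phi (gauge q)) =
    (fun q => (8 * psi (gauge q)) * q.2).
  by apply/funext => q; rewrite /dt (@derive_val _ _ _ _ _ _ _ (is_derive_comp_gauge_et (Dphi _))).
have dxE i : dx i (fun q => phi (gauge q)) =
    (fun q => (4 * psi (gauge q)) * (horiz q * q.1 0 i)).
  apply/funext => q.
  by rewrite /dx (@derive_val _ _ _ _ _ _ _ (is_derive_comp_gauge_ex i (Dphi _))) mulrA.
have dxx i : dx i (dx i (fun q => phi (gauge q))) p =
    (16 * theta * horiz p ^+ 2 + 8 * psi (gauge p)) * p.1 0 i ^+ 2
    + 4 * psi (gauge p) * horiz p.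
  rewrite dxE /dx.
  have D := is_deriveM (is_deriveZ 4 (is_derive_comp_gauge_ex i Dpsi))
    (is_deriveM (is_derive_horiz_ex p i) (is_derive_coord p (ex i) i)).
  have D' : is_derive p (ex i)
    (fun q => (4 * psi (gauge q)) * (horiz q * q.1 0 i))
    ((16 * theta * horiz p ^+ 2 + 8 * psi (gauge p)) * p.1 0 i ^+ 2
    + 4 * psi (gauge p) * horiz p).
    apply: (is_derive_congr D) => //; rewrite /= mxE !eqxx /GRing.scale/=.
    set w := (horiz * _) p; have -> : w = horiz p * p.1 0 i by [].
    by ring.
  exact: (@derive_val _ _ _ _ _ _ _ D').
have dtt : dt (dt (fun q => phi (gauge q))) p =
    64 * theta * p.2 ^+ 2 + 8 * psi (gauge p).
  rewrite dtE /dt.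
  have D := is_deriveM (is_deriveZ 8 (is_derive_comp_gauge_et Dpsi))
    (is_derive_last p et).
  have D' : is_derive p et (fun q => (8 * psi (gauge q)) * q.2)
    (64 * theta * p.2 ^+ 2 + 8 * psi (gauge p)).
    by apply: (is_derive_congr D) => //; rewrite /= /GRing.scale/=; ring.
  exact: (@derive_val _ _ _ _ _ _ _ D').
under eq_bigr => i _ do rewrite dxx.
rewrite dtt euclid_sqr big_split/= -mulr_sumr -/(horiz p).
by rewrite sumr_const card_ord -mulr_natr /gauge; ring.
Qed.

End Coordinates.

(** * A radial divergence theorem *)

Section Divergence.
Context (R : realType) (n : nat).
Local Notation T := (measurableTypeR R).
Implicit Types (v : n.+1.-tuple T) (p : 'rV[R]_n * R).

(** The variable t sits at the head, as in [tuple_cons], so that t and the x_i become coordinates of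
    one tuple and [integral_upd_eq0] treats them uniformly. *)
Definition point v : 'rV[R]_n * R :=
  (\row_i tnth v (lift ord0 i), tnth v ord0).

Lemma point_tuple_cons (q : n.-tuple T * T) : point (tuple_cons q) = of_tuple q.
Proof.
case: q => w a; congr pair; apply/rowP => i.
by rewrite !mxE tnth_tuple_consS.
Qed.

(** Removes the domain of integration: [F] is compared with [G] only on [A], and [G] is extended by
    zero. *)
Lemma lebesgue_int_tuple (A : set ('rV[R]_n * R)) (F : 'rV[R]_n * R -> R)
    (G : n.+1.-tuple T -> R) : measurable (@of_tuple R n @^-1` A) ->
  box_bounded G -> (forall v, A (point v) -> F (point v) = G v) ->
  (forall v, ~ A (point v) -> G v = 0) ->
  lebesgue_int A F = (\int[lebesgue_tuple R n.+1]_v (G v)%:E)%E.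
Proof.
move=> mA bG FG G0; rewrite /lebesgue_int integral_lebesgue_tupleS//.
rewrite integral_mkcond; apply: eq_integral => q _.
rewrite patchE -point_tuple_cons; case: ifPn => [|/negP]; rewrite inE /=.
  by rewrite -point_tuple_cons => /FG ->.
by rewrite -point_tuple_cons => /G0 ->.
Qed.

Lemma measurable_horiz_point : measurable_fun setT (fun v => horiz (point v)).
Proof.
rewrite /horiz; apply: (@measurable_sum _ _ _ _ _ _ (fun i v => (point v).1 0 i ^+ 2)).
move=> i; apply: measurable_funX.
under eq_fun do rewrite mxE.
exact: measurable_tnth.
Qed.

Lemma measurable_gauge_point : measurable_fun setT (fun v => gauge (point v)).
Proof.
apply: measurable_funD; first exact: measurable_funX measurable_horiz_point.
apply: measurable_funM => //; apply: measurable_funX; exact: measurable_tnth.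
Qed.

(** S² and t² are at most b, and x_i² is at most S. Since b is nonnegative here, both b and b + 1
    are at most (b + 1)², so one bound fits all three. *)
Lemma gauge_bounds p (b : R) : gauge p <= b ->
  [/\ `|horiz p| <= b + 1, `|p.2| <= b + 1 & forall i, `|p.1 0 i| <= b + 1].
Proof.
move=> pb; have b0 := le_trans (gauge_ge0 p) pb.
have h0 := horiz_ge0 p.
have sq (x : R) : x ^+ 2 <= (b + 1) ^+ 2 -> `|x| <= b + 1.
  by rewrite -[x ^+ 2]real_normK ?num_real// ler_pXn2r ?nnegrE ?addr_ge0.
have hb : `|horiz p| <= b + 1.
  by apply: sq; have := sqr_ge0 p.2; move: pb; rewrite /gauge; nra.
split => //.
  by apply: sq; have := sqr_ge0 (horiz p); move: pb; rewrite /gauge; nra.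
move=> i; apply: sq.
have : p.1 0 i ^+ 2 <= horiz p.
  by rewrite /horiz (bigD1 i)//= lerDl sumr_ge0// => j _; rewrite sqr_ge0.
by move: hb; rewrite ger0_norm//; nra.
Qed.

Lemma point_box v (b : R) : gauge (point v) <= b -> box (b + 1) v.
Proof.
move=> /gauge_bounds[_ h2 h1] i; case: (unliftP ord0 i) => [j ->|->//].
by have := h1 j; rewrite mxE.
Qed.

Lemma box_bounded_gauge (c : R -> R) (m : n.+1.-tuple T -> R) (a b D : R) :
  continuous c -> (forall y, ~ (a <= y <= b) -> c y = 0) ->
  measurable_fun setT m ->
  (forall v, gauge (point v) <= b -> `|m v| <= D) ->
  box_bounded (fun v => c (gauge (point v)) * m v).
Proof.
move=> cc c0 mm mD; split.
  apply: measurable_funM => //; apply: measurableT_comp measurable_gauge_point.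
  exact: continuous_measurable_fun.
have [C C0 cC] := compact_support_bounded cc c0.
have z v : ~ gauge (point v) <= b -> c (gauge (point v)) = 0.
  by move=> vb; apply: c0 => /andP[].
exists (`|C * D| + `|b + 1|) => v; split.
  have [vb|vb] := pselect (gauge (point v) <= b); last first.
    by rewrite z// mul0r normr0 addr_ge0.
  rewrite normrM (@le_trans _ _ (C * D))//.
    by rewrite ler_pM// mD.
  by rewrite (le_trans (ler_norm _))// lerDl.
move=> vb; rewrite z ?mul0r//; apply: contra_not vb => /point_box vb i.
by apply: le_trans (vb i) _; rewrite (le_trans (ler_norm _))// lerDr.
Qed.

Lemma box_bounded_horiz_gauge (h : R -> R) (a b : R) : continuous h ->
  (forall y, ~ (a <= y <= b) -> h y = 0) ->
  box_bounded (fun v => h (gauge (point v)) * horiz (point v)).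
Proof.
move=> ch h0; apply: (box_bounded_gauge (D := b + 1) ch h0).
  exact: measurable_horiz_point.
by move=> v /gauge_bounds[].
Qed.

Lemma point_upd_lift v i (s : R) : point (upd v (lift ord0 i) s) =
  s *: ex R i + point (upd v (lift ord0 i) 0).
Proof.
congr pair; last by rewrite /= !tnth_upd/= scaler0 add0r.
apply/rowP => j; rewrite !mxE !tnth_upd (inj_eq lift_inj) eqxx/=.
by case: eqP => _; rewrite ?mulr1 ?mulr0 ?addr0 ?add0r.
Qed.

Lemma point_upd0 v (s : R) :
  point (upd v ord0 s) = s *: @et R n + point (upd v ord0 0).
Proof.
congr pair; last by rewrite /= !tnth_upd/= addr0 [_ *: _]mulr1.
by apply/rowP => j; rewrite !mxE !tnth_upd/= mulr0 add0r.
Qed.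

Lemma is_derive_line (F : 'rV[R]_n * R -> R) (x w : 'rV[R]_n * R) (s d : R) :
  is_derive (s *: w + x) w F d -> is_derive s 1 (fun h : R => F (h *: w + x)) d.
Proof.
move=> /is_derive_lineP D; apply/is_derive_lineP.
apply: (is_derive_congr D) => // h.
by rewrite addrA -scalerDl [h *: 1]mulr1.
Qed.

Lemma continuous_line (F : 'rV[R]_n * R -> R) (x w : 'rV[R]_n * R) :
  (forall p, exists d : R, is_derive p w F d) ->
  continuous (fun h : R => F (h *: w + x)).
Proof.
move=> D s; have [d Dd] := D (s *: w + x).
exact: is_derive_continuous (is_derive_line Dd).
Qed.

Section Field.
Variables (K K' : R -> R) (a b : R).
Hypothesis dK : forall y : R, is_derive y 1 K (K' y).
Hypothesis cK' : continuous K'.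
Hypothesis K0 : forall y, ~ (a <= y <= b) -> K y = 0.
Hypothesis K'0 : forall y, ~ (a <= y <= b) -> K' y = 0.

Let cK : continuous K.
Proof. by move=> y; exact: is_derive_continuous (dK y). Qed.

(* [divx i] and [divt] are the derivatives of the i-th and the last component
   of the field K(N) S (x, 2t), each in its own coordinate. *)
Let divx (i : 'I_n) p : R :=
  K' (gauge p) * (4 * horiz p ^+ 2 * p.1 0 i ^+ 2)
  + K (gauge p) * (2 * p.1 0 i ^+ 2 + horiz p).

Let divt p : R :=
  K' (gauge p) * (16 * horiz p * p.2 ^+ 2) + K (gauge p) * (2 * horiz p).

(** The polynomial factors are unbounded, but they are multiplied by [K] or [K'], which vanish where
    [gauge] exceeds [b]. *)
Let bounded_measurable (m : n.+1.-tuple T -> R) : Prop :=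
  measurable_fun setT m /\ exists D, forall v, gauge (point v) <= b -> `|m v| <= D.

Let bmM m1 m2 : bounded_measurable m1 -> bounded_measurable m2 ->
  bounded_measurable (fun v => m1 v * m2 v).
Proof.
move=> [mm1 [D1 h1]] [mm2 [D2 h2]]; split; first exact: measurable_funM.
by exists (D1 * D2) => v vb; rewrite normrM ler_pM// ?h1 ?h2.
Qed.

Let bmD m1 m2 : bounded_measurable m1 -> bounded_measurable m2 ->
  bounded_measurable (fun v => m1 v + m2 v).
Proof.
move=> [mm1 [D1 h1]] [mm2 [D2 h2]]; split; first exact: measurable_funD.
by exists (D1 + D2) => v vb; apply: le_trans (ler_normD _ _) _; rewrite lerD ?h1 ?h2.
Qed.

Let bmC (k : R) : bounded_measurable (fun=> k).
Proof. by split; [exact: measurable_cst|exists `|k|]. Qed.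

Let bmH : bounded_measurable (fun v => horiz (point v)).
Proof.
split; first exact: measurable_horiz_point.
by exists (b + 1) => v /gauge_bounds[].
Qed.

Let bmx i : bounded_measurable (fun v => (point v).1 0 i).
Proof.
split; last by exists (b + 1) => v /gauge_bounds[].
by under eq_fun do rewrite mxE; exact: measurable_tnth.
Qed.

Let bmt : bounded_measurable (fun v => (point v).2).
Proof.
split; last by exists (b + 1) => v /gauge_bounds[].
exact: measurable_tnth.
Qed.

Let bmE (c : R -> R) m : continuous c -> (forall y, ~ (a <= y <= b) -> c y = 0) ->
  bounded_measurable m -> box_bounded (fun v => c (gauge (point v)) * m v).
Proof. by move=> cc c0 [mm [D mD]]; exact: (box_bounded_gauge cc c0 mm mD). Qed.

Let bb_divx i : box_bounded (fun v => divx i (point v)).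
Proof.
apply: box_boundedD; apply: bmE => //; rewrite ?expr2.
  by repeat (exact: bmC || exact: bmH || exact: bmx || apply: bmM).
by repeat (exact: bmC || exact: bmH || exact: bmx || apply: bmM || apply: bmD).
Qed.

Let bb_divt : box_bounded (fun v => divt (point v)).
Proof.
apply: box_boundedD; apply: bmE => //; rewrite ?expr2.
  by repeat (exact: bmC || exact: bmH || exact: bmt || apply: bmM).
by repeat (exact: bmC || exact: bmH || exact: bmt || apply: bmM || apply: bmD).
Qed.

Let is_derive_x (i : 'I_n) p : is_derive p (ex R i)
  (fun q => K (gauge q) * (horiz q * q.1 0 i)) (divx i p).
Proof.
have D := is_deriveM (is_derive_comp_gauge_ex i (dK (gauge p)))
  (is_deriveM (is_derive_horiz_ex p i) (is_derive_coord p (ex R i) i)).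
apply: (is_derive_congr D) => //; rewrite /= mxE !eqxx /GRing.scale/=.
set w := (@horiz R n * _) p; have -> : w = horiz p * p.1 0 i by [].
by rewrite /divx; ring.
Qed.

Let is_derive_t p : is_derive p (@et R n)
  (fun q => K (gauge q) * (2 * (horiz q * q.2))) (divt p).
Proof.
have D := is_deriveM (is_derive_comp_gauge_et (dK (gauge p)))
  (is_deriveZ 2 (is_deriveM (is_derive_horiz_et p) (is_derive_last p (@et R n)))).
apply: (is_derive_congr D) => //; rewrite /= /GRing.scale/=.
set w := (@horiz R n * _) p; have -> : w = horiz p * p.2 by [].
by rewrite /divt; ring.
Qed.

(** By [point_box], a coordinate larger than [b + 1] forces N > b. The absolute value keeps [M]
    positive when [b] is negative. *)
Let M := `|b| + 1.

Let gauge_M v k (s : R) : M < `|s| -> K (gauge (point (upd v k s))) = 0.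
Proof.
move=> Ms; apply: K0 => /andP[_ /point_box /(_ k)].
rewrite tnth_upd eqxx => sb; move: Ms; rewrite ltNge (le_trans sb)//.
by rewrite lerD2r ler_norm.
Qed.

Let M0 : 0 < M. Proof. by rewrite ltr_wpDl. Qed.

Let integral_divx i :
  (\int[lebesgue_tuple R n.+1]_v (divx i (point v))%:E = 0)%E.
Proof.
apply: (@integral_upd_eq0 _ _ _ (lift ord0 i)) => // v.
pose x := point (upd v (lift ord0 i) 0).
apply: (@integral_derivative_eq0 _ (fun s => K (gauge (point (upd v (lift ord0 i) s)))
   * (horiz (point (upd v (lift ord0 i) s)) * (point (upd v (lift ord0 i) s)).1 0 i)) _ M) => //.
- under eq_fun do rewrite point_upd_lift -/x.
  move=> s; rewrite point_upd_lift -/x.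
  exact: (is_derive_line (F := fun q => K (gauge q) * (horiz q * q.1 0 i))).
- under eq_fun do rewrite point_upd_lift -/x.
  have cg : continuous (fun s : R => gauge (s *: ex R i + x)).
    by apply: continuous_line => p; eexists; exact: is_derive_gauge.
  have ch : continuous (fun s : R => horiz (s *: ex R i + x)).
    by apply: continuous_line => p; eexists; exact: is_derive_horiz.
  have cx : continuous (fun s : R => (s *: ex R i + x).1 0 i).
    apply: (continuous_line (F := fun q => q.1 0 i)) => p; eexists.
    exact: is_derive_coord.
  move=> s; rewrite /divx; apply: cvgD; apply: cvgM.
  + by apply: continuous_comp; [exact: cg|exact: cK'].
  + apply: cvgM; last by apply: cvgM; exact: cx.
    by apply: cvgM; [exact: cvg_cst|apply: cvgM; exact: ch].
  + by apply: continuous_comp; [exact: cg|exact: cK].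
  + apply: cvgD; last exact: ch.
    by apply: cvgM; [exact: cvg_cst|apply: cvgM; exact: cx].
- by move=> s Ms; rewrite gauge_M// mul0r.
Qed.

Let integral_divt :
  (\int[lebesgue_tuple R n.+1]_v (divt (point v))%:E = 0)%E.
Proof.
apply: (@integral_upd_eq0 _ _ _ ord0) => // v.
pose x := point (upd v ord0 0).
apply: (@integral_derivative_eq0 _ (fun s => K (gauge (point (upd v ord0 s)))
   * (2 * (horiz (point (upd v ord0 s)) * (point (upd v ord0 s)).2))) _ M) => //.
- under eq_fun do rewrite point_upd0 -/x.
  move=> s; rewrite point_upd0 -/x.
  exact: (is_derive_line (F := fun q => K (gauge q) * (2 * (horiz q * q.2)))).
- under eq_fun do rewrite point_upd0 -/x.
  have cg : continuous (fun s : R => gauge (s *: @et R n + x)).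
    by apply: continuous_line => p; eexists; exact: is_derive_gauge.
  have ch : continuous (fun s : R => horiz (s *: @et R n + x)).
    by apply: continuous_line => p; eexists; exact: is_derive_horiz.
  have cx : continuous (fun s : R => (s *: @et R n + x).2).
    apply: (continuous_line (F := fun q => q.2)) => p; eexists.
    exact: is_derive_last.
  move=> s; rewrite /divt; apply: cvgD; apply: cvgM.
  + by apply: continuous_comp; [exact: cg|exact: cK'].
  + apply: cvgM; last by apply: cvgM; exact: cx.
    by apply: cvgM; [exact: cvg_cst|exact: ch].
  + by apply: continuous_comp; [exact: cg|exact: cK].
  + by apply: cvgM; [exact: cvg_cst|exact: ch].
- by move=> s Ms; rewrite gauge_M// mul0r.
Qed.

(** The coefficient n + 4 of K collects n from the divergence of x, 2 from that of 2t, and 2 from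
    the degree of S; 4 N is the derivative of N along (x, 2t). *)
Lemma integral_radial_divergence : (\int[lebesgue_tuple R n.+1]_v
  ((4 * gauge (point v) * K' (gauge (point v))
    + (n%:R + 4) * K (gauge (point v))) * horiz (point v))%:E = 0)%E.
Proof.
transitivity (\int[lebesgue_tuple R n.+1]_v
  (\sum_(i < n) (divx i (point v))%:E + (divt (point v))%:E))%E.
  apply: eq_integral => v _; rewrite sumEFin -EFinD; congr EFin.
  rewrite big_split/= -!mulr_sumr big_split/= -mulr_sumr -/(horiz (point v)).
  by rewrite sumr_const card_ord -mulr_natr /divt /gauge; ring.
have bx i := box_bounded_integrable (bb_divx i).
have bt := box_bounded_integrable bb_divt.
have bs : (lebesgue_tuple R n.+1).-integrable setT
    (fun v => \sum_(i < n) (divx i (point v))%:E)%E.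
  by apply: (integrable_sum measurableT) => i _; exact: bx.
rewrite (integralD measurableT bs bt) [X in (_ + X)%E]integral_divt adde0.
rewrite (integral_sum measurableT bx) big1// => i _.
exact: integral_divx.
Qed.

End Field.

End Divergence.

(** * The profile of a radial test function *)

Section ContinuityAt.
Context (R : realType).
Implicit Types (F G : R -> R) (y : R).

(** A name for the goal that the tactic [cont_at] can match syntactically. *)
Definition cont_at F y : Prop := {for y, continuous F}.

Lemma cont_atD F G y : cont_at F y -> cont_at G y ->
  cont_at (fun z => F z + G z) y.
Proof. by move=> cF cG; apply: cvgD. Qed.

Lemma cont_atN F y : cont_at F y -> cont_at (fun z => - F z) y.
Proof. by move=> cF; apply: cvgN. Qed.

Lemma cont_atM F G y : cont_at F y -> cont_at G y ->
  cont_at (fun z => F z * G z) y.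
Proof. by move=> cF cG; apply: cvgM. Qed.

Lemma cont_atX F k y : cont_at F y -> cont_at (fun z => F z ^+ k) y.
Proof.
move=> cF; apply: (@continuous_comp _ _ _ F (fun x => x ^+ k) y cF).
exact: exprn_continuous.
Qed.

Lemma cont_atV F y : F y != 0 -> cont_at F y -> cont_at (fun z => (F z)^-1) y.
Proof. by move=> F0 cF; apply: cvgV. Qed.

Lemma cont_at_cst (c : R) y : cont_at (fun=> c) y.
Proof. exact: cvg_cst. Qed.

Lemma continuous_root4 : continuous (@root4 R).
Proof.
move=> y; apply: (@continuous_comp _ _ _ Num.sqrt Num.sqrt).
  exact: sqrt_continuous.
exact: sqrt_continuous.
Qed.

End ContinuityAt.

(** Recursion on the syntax of the function. The nonvanishing of denominators is left to
    [assumption], so callers first state it for each denominator as it is written. *)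
Ltac cont_at := repeat lazymatch goal with
| |- cont_at (fun z => @Algebra.add _ (@?A z) (@?B z)) _ =>
    apply: (@cont_atD _ A B)
| |- cont_at (fun z => @GRing.mul _ (@?A z) (@?B z)) _ =>
    apply: (@cont_atM _ A B)
| |- cont_at (fun z => @Algebra.opp _ (@?A z)) _ => apply: (@cont_atN _ A)
| |- cont_at (fun z => @GRing.exp _ (@?A z) ?k) _ => apply: (@cont_atX _ A k)
| |- cont_at (fun z => @GRing.inv _ (@?A z)) _ => apply: (@cont_atV _ A)
| |- cont_at (fun _ => ?c) _ => apply: (@cont_at_cst _ c)
| |- _ => assumption
end.

Section Profile.
Context (R : realType) (n : nat).
Implicit Types (u : 'rV[R]_n * R -> R).

(** Off [[a, b]] the function is locally zero, so its derivative is 0 there. As a > 0, this carries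
    a formula valid for y > 0 over to the whole line, provided its default value for y <= 0 is 0. *)
Lemma derivative_compact_support (F F' : R -> R) (a b : R) : 0 < a ->
  (forall y, ~ (a <= y <= b) -> F y = 0) ->
  (forall y : R, 0 < y -> is_derive y 1 F (F' y)) ->
  (forall y, y <= 0 -> F' y = 0) ->
  (forall y, ~ (a <= y <= b) -> F' y = 0) /\
  (forall y : R, is_derive y 1 F (F' y)).
Proof.
move=> a0 F0 dF F'0.
have Dout (y : R) : ~ (a <= y <= b) -> is_derive y 1 F 0.
  move=> yab; apply: (is_derive_near (is_derive_cst 0 y 1) (nbhs_itv_complement yab)).
  by move=> z /F0.
have out (y : R) : ~ (a <= y <= b) -> F' y = 0.
  move=> yab; have [y0|y0] := leP y 0; first exact: F'0.
  by have [_ <-] := dF y y0; have [_ ->] := Dout y yab.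
split=> // y; have [y0|y0] := ltP 0 y; first exact: dF.
have yab : ~ (a <= y <= b).
  by move=> /andP[ay _]; move: (lt_le_trans a0 ay); rewrite ltNge y0.
by rewrite out//; exact: Dout.
Qed.

Lemma continuous_gauge : continuous (@gauge R n).
Proof.
have ch : continuous (@horiz R n).
  apply: continuous_big => [|i _ p]; first exact: add_continuous.
  apply: (@continuous_comp _ _ _ (fun q : 'rV[R]_n * R => q.1 0 i)
    (fun z : R => z ^+ 2) p); last exact: exprn_continuous.
  apply: (@continuous_comp _ _ _ fst (fun M : 'rV[R]_n => M 0 i) p).
    exact: cvg_fst.
  exact: coord_continuous.
move=> p; apply: cvgD; first by apply: cvgM; exact: ch.
apply: cvgM; first exact: cvg_cst.
by apply: cvgM; exact: cvg_snd.
Qed.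

Lemma smooth_vertical u : smooth u ->
  [/\ forall t : R, is_derive t 1 (fun s => u (0, s)) (dt u (0, t)),
      forall t : R, is_derive t 1 (fun s => dt u (0, s)) (dt (dt u) (0, t))
    & continuous (fun s : R => dt (dt u) (0, s))].
Proof.
(* Order three, because continuity of the second derivative is read off the differentiability of
   [dt (dt u)]. *)
move=> /(_ 3%N) [du /(_ (@et R n)) [ddu /(_ (@et R n)) [dddu _]]].
have line (F : 'rV[R]_n * R -> R) (t : R) : (forall x, differentiable F x) ->
    is_derive t 1 (fun s => F (0, s)) (dt F (0, t)).
  move=> dF.
  have E (h : R) : h *: @et R n + 0 = (0, h).
    by congr pair; rewrite /= ?scaler0 ?addr0// [_ *: _]mulr1.
  rewrite -E; apply: (is_derive_congr (F := fun h : R => F (h *: @et R n + 0))).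
  - apply: (is_derive_line (d := 'D_(@et R n) F (t *: @et R n + 0))).
    by apply: derivableP; exact: diff_derivable.
  - by move=> h; rewrite E.
  - by [].
split=> t; [exact: line|exact: line|].
exact: is_derive_continuous (line (dt (dt u)) t dddu).
Qed.

Lemma gauge_vertical (y : R) : 0 <= y ->
  gauge ((0, Num.sqrt y / 2) : 'rV[R]_n * R) = y.
Proof.
move=> y0; rewrite /gauge /horiz/= big1; last by move=> i _; rewrite mxE expr0n.
by rewrite expr0n/= add0r expr_div_n sqr_sqrtr//; field.
Qed.

(** The gauge attains its extrema on the compact support: the minimum is positive because the
    support misses the origin, and the maximum stays inside the open ball. *)
Lemma gauge_support (rad : \bar R) u : (0 < rad)%E ->
  test_function (ballG rad `\ (0 : 'rV[R]_n * R)) u ->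
  exists a b : R, [/\ 0 < a, ((root4 b)%:E < rad)%E &
    forall p, u p != 0 -> a <= gauge p <= b].
Proof.
move=> rad0 [_]; set A := closure _ => cA sA.
have supA p : u p != 0 -> A p by move=> up; exact: subset_closure.
have [A0|/set0P A0] := eqVneq A set0.
  (* For u = 0 the empty interval [[1, 0]] is chosen; later statements allow [b < a]. *)
  exists 1, 0; split => //; first by rewrite /root4 !sqrtr0.
  by move=> p /supA; rewrite A0.
have cg : {within A, continuous (@gauge R n)}.
  by apply: continuous_subspaceT; exact: continuous_gauge.
have [c cinA cmin] := compact_EVT_min A0 cA cg.
have [d dinA dmax] := compact_EVT_max A0 cA cg.
exists (gauge c), (gauge d); split.
- rewrite lt_neqAle gauge_ge0 andbT eq_sym; apply/eqP => /gauge_eq0 c0.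
  by move: cinA; rewrite inE => /sA[_]; apply.
- by move: dinA; rewrite inE => /sA[]; rewrite /ballG/= rho_gauge.
- by move=> p /supA Ap; rewrite cmin ?dmax// inE.
Qed.

(* The profile is read off the vertical axis, where the gauge is [4 t^2]. *)
Lemma radial_profile (rad : \bar R) u : (0 < rad)%E ->
  test_function (ballG rad `\ (0 : 'rV[R]_n * R)) u -> radial u ->
  exists (phi psi theta : R -> R) (a b : R),
    [/\ 0 < a, ((root4 b)%:E < rad)%E, forall p, u p = phi (gauge p) &
     [/\ forall y : R, is_derive y 1 phi (psi y),
         forall y : R, is_derive y 1 psi (theta y),
         forall y : R, 0 < y -> {for y, continuous theta},
         forall y, ~ (a <= y <= b) -> psi y = 0
       & forall y, ~ (a <= y <= b) -> theta y = 0]].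
Proof.
move=> rad0 hu [g ug]; have [a [b [a0 brad ab]]] := gauge_support rad0 hu.
have [dchi ddchi cchi] := smooth_vertical (let: And3 s _ _ := hu in s).
set chi := fun s : R => u (0, s) in dchi.
set chi1 := fun s : R => dt u (0, s) in ddchi.
set chi2 := fun s : R => dt (dt u) (0, s) in cchi.
(* Solves 4 t² = y for t. For y > 0, [psi] and [theta] are the first two derivatives of [chi]
   composed with [h]; for y <= 0 the conventions for [Num.sqrt] and [0^-1] make them 0. *)
pose h (y : R) : R := Num.sqrt y / 2.
pose phi y := chi (h y).
pose psi y := chi1 (h y) / (4 * Num.sqrt y).
pose theta y := chi2 (h y) / (16 * Num.sqrt y ^+ 2)
  - chi1 (h y) / (8 * Num.sqrt y ^+ 3).
have sq0 (y : R) : y <= 0 -> Num.sqrt y = 0.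
  by move=> y0; apply/eqP; rewrite sqrtr_eq0.
have uphi p : u p = phi (gauge p).
  by rewrite /phi /chi !ug !rho_gauge gauge_vertical// gauge_ge0.
have phi0 y : ~ (a <= y <= b) -> phi y = 0.
  move=> yab; apply: contra_notP yab => /eqP /ab.
  have [y0|y0] := leP 0 y; first by rewrite gauge_vertical.
  rewrite /h sq0 ?(ltW y0)// mul0r.
  by rewrite (gauge0 R n) => /andP[]; rewrite leNgt a0.
have dh (y : R) : 0 < y -> is_derive y 1 h (4 * Num.sqrt y)^-1.
  move=> y0; have D := is_deriveM (is_derive1_sqrt y0) (is_derive_cst (2^-1 : R) y 1).
  apply: (is_derive_congr D) => //.
  rewrite scaler0 add0r /GRing.scale/=.
  by field; rewrite gt_eqF// sqrtr_gt0.
have dphi (y : R) : 0 < y -> is_derive y 1 phi (psi y).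
  by move=> y0; exact: is_derive_comp (dh y y0) (dchi _).
have dpsi (y : R) : 0 < y -> is_derive y 1 psi (theta y).
  move=> y0; have s0 : Num.sqrt y != 0 by rewrite gt_eqF// sqrtr_gt0.
  have D1 := is_derive_comp (dh y y0) (ddchi _).
  have D2 := is_deriveM (is_derive_cst (4 : R) y 1) (is_derive1_sqrt y0).
  have n4 : (cst 4 * Num.sqrt) y != 0 by rewrite mulf_neq0// pnatr_eq0.
  have D3 := is_deriveM D1 (is_deriveV n4 D2).
  apply: (is_derive_congr D3) => //.
  rewrite /theta /= /GRing.scale/=.
  have -> : (cst 4 * Num.sqrt) y = 4 * Num.sqrt y by [].
  by rewrite -/(chi2 (h y)); field; rewrite s0.
have [psi0 dphi'] : (forall y, ~ (a <= y <= b) -> psi y = 0) /\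
    (forall y : R, is_derive y 1 phi (psi y)).
  apply: (derivative_compact_support a0 phi0 dphi) => y y0.
  by rewrite /psi sq0// mulr0 invr0 mulr0.
have [theta0 dpsi'] : (forall y, ~ (a <= y <= b) -> theta y = 0) /\
    (forall y : R, is_derive y 1 psi (theta y)).
  apply: (derivative_compact_support a0 psi0 dpsi) => y y0.
  by rewrite /theta sq0// !expr0n/= !mulr0 invr0 !mulr0 subr0.
exists phi, psi, theta, a, b; split=> //; split=> // y y0.
have s0 : Num.sqrt y != 0 by rewrite gt_eqF// sqrtr_gt0.
have n2 : 16 * Num.sqrt y ^+ 2 != 0 by rewrite mulf_neq0 ?pnatr_eq0// expf_neq0.
have n3 : 8 * Num.sqrt y ^+ 3 != 0 by rewrite mulf_neq0 ?pnatr_eq0// expf_neq0.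
have cs : cont_at (fun z => Num.sqrt z) y by exact: sqrt_continuous.
have ch : cont_at h y by rewrite /h; cont_at.
have c1 : cont_at (fun z => chi1 (h z)) y.
  apply: (@continuous_comp _ _ _ h chi1 y ch).
  exact: is_derive_continuous (ddchi _).
have c2 : cont_at (fun z => chi2 (h z)) y.
  by apply: (@continuous_comp _ _ _ h chi2 y ch); exact: cchi.
rewrite -/(cont_at theta y) /theta; cont_at.
Qed.

End Profile.

(** * The Bessel pair and the radial densities *)

Section BesselIdentity.
Context (R : realType) (n : nat) (rad : \bar R) (V W f : R -> R).
Hypothesis n_gt0 : (0 < n)%N.
Hypothesis hVW : bessel_pair (n + 2) rad V W f.

(** Since Q - 1 = n + 1, dividing the flux by z^n leaves z V f', the only combination through which
    f' enters [weight]. Its derivative comes from the equation, without f''. *)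
Lemma is_derive_flux (s : R) : interval0 rad s ->
  is_derive s 1 (fun z => z * V z * derive1 f z)
    (- (s * W s * f s) - n%:R * V s * derive1 f s).
Proof.
move=> si; have [_ _ _ _ /(_ s si)[dF F']] := hVW.
have s0 : 0 < s := si.1; have sn0 : s != 0 by rewrite gt_eqF.
set F := fun r => _ in dF F'.
have D1 : is_derive s 1 F (- (s ^+ (n + 2).-1 * W s * f s)).
  apply: DeriveDef => //; rewrite -derive1E.
  by apply/eqP; rewrite -addr_eq0 F'.
pose P (z : R) := z ^+ n.
have D2 : is_derive s 1 P (n%:R * s ^+ n.-1).
  apply: DeriveDef; first exact: exprn_derivable.
  by rewrite exp_derive /GRing.scale/= mulr1.
have sN : P s != 0 by rewrite expf_neq0.
have D3 := is_deriveM D1 (is_deriveV sN D2).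
have s_nbhs : nbhs s [set z | 0 < z] by exact: lt_nbhsr.
apply: (@is_derive_near _ _ (fun z => F z * (z ^+ n)^-1) _ _ s 1 _ _ s_nbhs).
  apply: (is_derive_congr D3) => //.
  rewrite /= /GRing.scale/= /F /P addn2 /=.
  case: n n_gt0 => // m _ /=.
  have c0 : s ^+ m != 0 by rewrite expf_neq0.
  rewrite !exprS; field.
  by rewrite c0 sn0.
move=> z /= z0; have zn0 : z ^+ n != 0 by rewrite expf_neq0// gt_eqF.
by rewrite /F addn2 /= exprS; field.
Qed.

Let f' := derive1 f.
Let V' := derive1 V.

(* With w = 4 r^3 psi(r^4) the derivative of u in r, the one-dimensional identity
   has the boundary term r^(Q-1) V f' w^2 / f + (Q-1) r^(Q-2) V w^2, which is
   r^(Q+2) psi(r^4)^2 times the weight at r. *)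
Definition weight (z : R) : R :=
  16 * z ^+ 2 * (z * V z * f' z / f z + (n%:R + 1) * V z).

(** The derivative of [weight] with (z V f')' eliminated by the Bessel equation; this is where W
    enters. *)
Definition dweight (z : R) : R :=
  32 * z * (z * V z * f' z / f z + (n%:R + 1) * V z)
  + 16 * z ^+ 2 * ((- (z * W z * f z) - n%:R * V z * f' z) / f z
      - z * V z * f' z ^+ 2 / f z ^+ 2 + (n%:R + 1) * V' z).

Lemma f_neq0 s : interval0 rad s -> f s != 0.
Proof. by move=> si; have [_ _ _ /(_ s si) f0 _] := hVW; rewrite gt_eqF. Qed.

Lemma is_derive_f s : interval0 rad s -> is_derive s 1 f (f' s).
Proof.
move=> si; have [_ _ /(_ s si)[df _] _ _] := hVW.
by rewrite /f' derive1E; exact: derivableP.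
Qed.

Lemma is_derive_V s : interval0 rad s -> is_derive s 1 V (V' s).
Proof.
move=> si; have [/(_ s si)[dV _] _ _ _ _] := hVW.
by rewrite /V' derive1E; exact: derivableP.
Qed.

Lemma is_derive_weight s : interval0 rad s ->
  is_derive s 1 weight (dweight s).
Proof.
move=> si; have f0 := f_neq0 si.
have D1 := is_deriveM (is_derive_flux si) (is_deriveV f0 (is_derive_f si)).
have D2 := is_deriveD D1 (is_deriveZ (n%:R + 1) (is_derive_V si)).
have D3 := is_deriveM (is_deriveZ 16 (is_deriveX 2 (is_derive_id s 1))) D2.
apply: (is_derive_congr D3) => //.
rewrite /= /GRing.scale/= /dweight -/f'.
set w := ((fun z : R => z * V z * f' z) * _ + _) s.
have -> : w = s * V s * f' s / f s + (n%:R + 1) * V s by [].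
by rewrite [(id ^+ 2) s](_ : _ = s ^+ 2)//; field.
Qed.

End BesselIdentity.

Section RadialDensities.
Context (R : realType) (n : nat) (rad : \bar R) (V W f : R -> R).
Hypothesis n_gt0 : (0 < n)%N.
Hypothesis hVW : bessel_pair (n + 2) rad V W f.
Variables (psi theta : R -> R) (a b : R).
Hypothesis a0 : 0 < a.
Hypothesis brad : ((root4 b)%:E < rad)%E.
Hypothesis dpsi : forall y : R, is_derive y 1 psi (theta y).
Hypothesis ctheta : forall y : R, 0 < y -> {for y, continuous theta}.
Hypothesis psi0 : forall y, ~ (a <= y <= b) -> psi y = 0.
Hypothesis theta0 : forall y, ~ (a <= y <= b) -> theta y = 0.

Local Notation f' := (derive1 f).
Local Notation V' := (derive1 V).

Lemma root4_interval0 y : a <= y <= b -> 0 < y /\ interval0 rad (root4 y).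
Proof.
move=> /andP[ay yb]; have y0 := lt_le_trans a0 ay; split=> //; split.
  by rewrite root4_gt0.
apply: le_lt_trans brad; rewrite lee_fin /root4.
by do 2 apply: ler_wsqrtr.
Qed.

Lemma continuous_at_root4 (g : R -> R) y : {for root4 y, continuous g} ->
  {for y, continuous (fun z => g (root4 z))}.
Proof.
move=> cg; apply: (@continuous_comp _ _ _ (@root4 R) g y) => //.
exact: continuous_root4.
Qed.

(** The function u_ρ / f in the variable y = ρ^4, with u_ρ = 4 ρ³ psi. *)
Definition radial_quotient (y : R) : R := 4 * root4 y ^+ 3 * psi y / f (root4 y).

Definition dradial_quotient (y : R) : R :=
  3 * psi y / (root4 y * f (root4 y)) + 4 * root4 y ^+ 3 * theta y / f (root4 y)
  - psi y * f' (root4 y) / f (root4 y) ^+ 2.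

Lemma dradial_quotient0 y : ~ (a <= y <= b) -> dradial_quotient y = 0.
Proof.
by move=> yab; rewrite /dradial_quotient psi0// theta0//; ring.
Qed.

Lemma is_derive_radial_quotient (y : R) :
  is_derive y 1 radial_quotient (dradial_quotient y).
Proof.
(* Off [[a, b]] nothing is known about [f], but [psi] vanishes near [y], so the quotient is locally
   zero. *)
have [yab|yab] := pselect (a <= y <= b); last first.
  rewrite (dradial_quotient0 yab).
  apply: (is_derive_near (is_derive_cst 0 y 1) (nbhs_itv_complement yab)) => z zab.
  by rewrite /radial_quotient psi0// mulr0 mul0r.
have [y0 yi] := root4_interval0 yab.
have r0 : root4 y != 0 by rewrite gt_eqF// root4_gt0.
have f0 := f_neq0 hVW yi.
have dr := is_derive_root4 y0.
have D1 := is_derive_comp dr (is_derive_f hVW yi).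
have D2 := is_deriveM (is_deriveX 3 dr) (dpsi y).
have D3 := is_deriveM (is_deriveZ 4 D2) (is_deriveV f0 D1).
apply: (is_derive_congr D3) => [z|].
  by rewrite /radial_quotient -[4 * root4 z ^+ 3 * psi z]mulrA.
rewrite /= /GRing.scale/= /dradial_quotient.
set w := (_ * psi) y; have -> : w = root4 y ^+ 3 * psi y by [].
set w1 := (_ ^+ 3) y; have -> : w1 = root4 y ^+ 3 by [].
by field; rewrite r0 f0.
Qed.

Definition radial_field (y : R) : R := weight n V f (root4 y) * psi y ^+ 2.

Definition dradial_field (y : R) : R :=
  dweight n V W f (root4 y) / (4 * root4 y ^+ 3) * psi y ^+ 2
  + weight n V f (root4 y) * (2 * psi y * theta y).

Lemma radial_field0 y : ~ (a <= y <= b) -> radial_field y = 0.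
Proof. by move=> yab; rewrite /radial_field psi0// expr0n mulr0. Qed.

Lemma dradial_field0 y : ~ (a <= y <= b) -> dradial_field y = 0.
Proof.
by move=> yab; rewrite /dradial_field psi0//; ring.
Qed.

Lemma is_derive_radial_field (y : R) :
  is_derive y 1 radial_field (dradial_field y).
Proof.
have [yab|yab] := pselect (a <= y <= b); last first.
  rewrite (dradial_field0 yab).
  apply: (is_derive_near (is_derive_cst 0 y 1) (nbhs_itv_complement yab)) => z zab.
  by rewrite radial_field0.
have [y0 yi] := root4_interval0 yab.
have D1 := is_derive_comp (is_derive_root4 y0) (is_derive_weight n_gt0 hVW yi).
have D2 := is_deriveM D1 (is_deriveX 2 (dpsi y)).
apply: (is_derive_congr D2) => //.
rewrite /= /GRing.scale/= /dradial_field.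
set w := (psi ^+ 2) y; have -> : w = psi y ^+ 2 by [].
by field; rewrite gt_eqF// root4_gt0.
Qed.

(* The integrands of the theorem are these densities at [gauge p], times
   [horiz p]. *)
Definition density_op (y : R) : R := V (root4 y) * root4 y ^+ 2
  * (16 * y * theta y + 4 * (n%:R + 4) * psi y) ^+ 2.

Definition density_W (y : R) : R := W (root4 y) * (16 * psi y ^+ 2 * y).

Definition density_V (y : R) : R :=
  (V (root4 y) / root4 y ^+ 2 - V' (root4 y) / root4 y) * (16 * psi y ^+ 2 * y).

Definition density_rem (y : R) : R :=
  V (root4 y) * (16 * dradial_quotient y ^+ 2 * y) * f (root4 y) ^+ 2.

Definition density_div (y : R) : R :=
  4 * y * dradial_field y + (n%:R + 4) * radial_field y.

Lemma density_op0 y : ~ (a <= y <= b) -> density_op y = 0.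
Proof.
by move=> yab; rewrite /density_op psi0// theta0//; ring.
Qed.

Lemma density_W0 y : ~ (a <= y <= b) -> density_W y = 0.
Proof. by move=> yab; rewrite /density_W psi0//; ring. Qed.

Lemma density_V0 y : ~ (a <= y <= b) -> density_V y = 0.
Proof. by move=> yab; rewrite /density_V psi0//; ring. Qed.

Lemma density_rem0 y : ~ (a <= y <= b) -> density_rem y = 0.
Proof.
by move=> yab; rewrite /density_rem dradial_quotient0//; ring.
Qed.

Lemma density_div0 y : ~ (a <= y <= b) -> density_div y = 0.
Proof.
move=> yab.
by rewrite /density_div radial_field0// dradial_field0// !mulr0 addr0.
Qed.

(** Put w = u_ρ. Writing w' = f (w/f)' + w f'/f and using the equation turns V w'² into V f²
    ((w/f)')² + W w² plus the derivative of r^(Q-1) V f' w²/f, up to the factor r^(Q-1). The cross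
    term 2 (Q-1) V w w'/r, integrated by parts and added to (Q-1)² V w²/r², leaves (Q-1) (V/r² -
    V'/r) w² plus the second boundary term. *)
Lemma density_identity y : density_op y =
  density_W y + (n%:R + 1) * density_V y + density_rem y + density_div y.
Proof.
have [yab|yab] := pselect (a <= y <= b); last first.
  rewrite density_op0// density_W0// density_V0// density_rem0// density_div0//.
  by rewrite mulr0 !addr0.
have [y0 yi] := root4_interval0 yab.
have f0 := f_neq0 hVW yi.
have r0 : root4 y != 0 by rewrite gt_eqF// root4_gt0.
rewrite /density_op /density_W /density_V /density_rem /density_div.
rewrite /dradial_field /radial_field /dradial_quotient /weight /dweight.
(* In r = [root4 y] the claim is a rational identity with denominators r and f(r) only. *)
have -> : y = root4 y ^+ 4 by rewrite root4K// ltW.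
have -> : root4 (root4 y ^+ 4) = root4 y by rewrite root4K// ltW.
move: (root4 y) f0 r0 => r f0 r0.
by field; rewrite f0 r0.
Qed.

Lemma density_continuity y : a <= y <= b ->
  [/\ {for y, continuous density_op}, {for y, continuous density_W},
      {for y, continuous density_V}, {for y, continuous density_rem}
    & {for y, continuous dradial_field}].
Proof.
move=> yab; have [y0 yi] := root4_interval0 yab.
have f0 := f_neq0 hVW yi.
have r0 : root4 y != 0 by rewrite gt_eqF// root4_gt0.
have [/(_ _ yi)[dV cV'] /(_ _ yi)[dW _] /(_ _ yi)[df cf'] _ _] := hVW.
have cont (g : R -> R) : derivable g (root4 y) 1 ->
    cont_at (fun z => g (root4 z)) y.
  move=> dg; apply: continuous_at_root4.
  exact: is_derive_continuous (derivableP dg).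
have cV := cont _ dV; have cW := cont _ dW; have cf := cont _ df.
have cV1 : cont_at (fun z => V' (root4 z)) y := continuous_at_root4 cV'.
have cf1 : cont_at (fun z => f' (root4 z)) y := continuous_at_root4 cf'.
have ct : cont_at (fun z => theta z) y := ctheta y0.
have cp : cont_at (fun z => psi z) y := is_derive_continuous (dpsi y).
have cr : cont_at (fun z => root4 z) y by exact: continuous_root4.
have ci : cont_at (fun z => z) y by exact: cvg_id.
have nz1 : root4 y * f (root4 y) != 0 by rewrite mulf_neq0.
have nz2 : f (root4 y) ^+ 2 != 0 by rewrite expf_neq0.
have nz3 : root4 y ^+ 2 != 0 by rewrite expf_neq0.
have nz4 : 4 * root4 y ^+ 3 != 0 by rewrite mulf_neq0 ?pnatr_eq0// expf_neq0.
split; [rewrite -/(cont_at density_op y) /density_op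
  |rewrite -/(cont_at density_W y) /density_W
  |rewrite -/(cont_at density_V y) /density_V
  |rewrite -/(cont_at density_rem y) /density_rem /dradial_quotient
  |rewrite -/(cont_at dradial_field y) /dradial_field /weight /dweight].
all: cont_at.
Qed.

Lemma continuous_dradial_field : continuous dradial_field.
Proof.
apply: (continuous_compact_support _ dradial_field0) => y.
by case/density_continuity.
Qed.

Local Notation T := (measurableTypeR R).
Local Notation density_integrand h := (fun v : n.+1.-tuple T =>
  h (gauge (point v)) * horiz (point v)).

Lemma box_bounded_density (h : R -> R) :
  (forall y, a <= y <= b -> {for y, continuous h}) ->
  (forall y, ~ (a <= y <= b) -> h y = 0) -> box_bounded (density_integrand h).
Proof.
move=> ch h0; apply: (@box_bounded_horiz_gauge _ _ h a b _ h0).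
exact: (continuous_compact_support ch h0).
Qed.

Lemma integral_density_identity :
  (\int[lebesgue_tuple R n.+1]_v (density_integrand density_op v)%:E
   = \int[lebesgue_tuple R n.+1]_v (density_integrand density_W v)%:E
     + (n%:R + 1)%:E
       * \int[lebesgue_tuple R n.+1]_v (density_integrand density_V v)%:E
     + \int[lebesgue_tuple R n.+1]_v (density_integrand density_rem v)%:E)%E.
Proof.
have bW : box_bounded (density_integrand density_W).
  by apply: box_bounded_density density_W0 => y /density_continuity[].
have bV : box_bounded (density_integrand density_V).
  by apply: box_bounded_density density_V0 => y /density_continuity[].
have bE : box_bounded (density_integrand density_rem).
  by apply: box_bounded_density density_rem0 => y /density_continuity[].
have bD : box_bounded (density_integrand density_div).
  apply: box_bounded_density density_div0 => y /density_continuity[_ _ _ _ c].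
  have ci : cont_at (fun z => z) y by exact: cvg_id.
  have cd : cont_at (fun z => dradial_field z) y by [].
  have cF : cont_at (fun z => radial_field z) y.
    exact: is_derive_continuous (is_derive_radial_field y).
  rewrite -/(cont_at density_div y) /density_div; cont_at.
have bVZ := box_boundedZ (n%:R + 1) bV.
have bS := box_boundedD bW bVZ; have bSE := box_boundedD bS bE.
rewrite -integral_box_boundedZ// -integral_box_boundedD//.
rewrite -integral_box_boundedD//.
have div0 := integral_radial_divergence n is_derive_radial_field
  continuous_dradial_field radial_field0 dradial_field0.
rewrite -[RHS]adde0 -[X in (_ + X)%E]div0 -integral_box_boundedD//.
apply: eq_integral => v _; congr EFin.
by rewrite density_identity /density_div; ring.
Qed.

End RadialDensities.

(** * Return to the ball and to the integrands of the theorem *)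

Lemma measurable_ballG (R : realType) (n : nat) (rad : \bar R) :
  measurable (@of_tuple R n @^-1` ballG rad).
Proof.
have mr : measurable_fun setT (fun q => rho (@of_tuple R n q)).
  under eq_fun do rewrite rho_gauge -point_tuple_cons.
  apply: (@measurableT_comp _ _ _ _ _ _ (@root4 R)).
    by apply: continuous_measurable_fun; exact: continuous_root4.
  apply: (@measurableT_comp _ _ _ _ _ _ (fun v => gauge (point v))).
    exact: measurable_gauge_point.
  exact: measurable_tuple_cons.
case: rad => [r||].
- have -> : @of_tuple R n @^-1` ballG r%:E =
      (fun q => rho (@of_tuple R n q)) @^-1` `]-oo, r[.
    by apply/seteqP; split=> q; rewrite /ballG/= lte_fin in_itv.
  by rewrite -[X in measurable X]setTI; exact: mr.
- rewrite (_ : _ @^-1` _ = setT)//.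
  by apply/seteqP; split=> q //= _; rewrite /ballG/= ltry.
- rewrite (_ : _ @^-1` _ = set0)//.
  by apply/seteqP; split=> q //=; rewrite /ballG/= ltNge leNye.
Qed.

(** [sqnorm_gradG] with d = 1/(4 ρ³). The origin is excluded because [root4] is not differentiable
    at 0. *)
Lemma sqnorm_gradG_rho (R : realType) (n : nat) (p : 'rV[R]_n * R) :
  0 < gauge p -> sqnorm (gradG rho p) = horiz p / root4 (gauge p) ^+ 2.
Proof.
move=> p0; have D := is_derive_root4 p0.
have -> : @rho R n = fun q => root4 (gauge q).
  by apply/funext => q; rewrite rho_gauge.
rewrite (sqnorm_gradG (fun i => is_derive_comp_gauge_ex i D)
  (is_derive_comp_gauge_et D)).
rewrite -{2}(root4K (ltW p0)).
by field; rewrite gt_eqF// root4_gt0.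
Qed.

Theorem theorem1p2 (R : realType) (n Q : nat) (hn : (2 <= n)%N)
    (hQ : Q = (n + 2)%N) (rad : \bar R) (hrad : (0 < rad)%E)
    (V W f : R -> R) (hVW : bessel_pair Q rad V W f)
    (u : 'rV[R]_n * R -> R)
    (hu : test_function (ballG rad `\ (0 : 'rV[R]_n * R)) u)
    (hur : radial u) :
  lebesgue_int (ballG rad)
    (fun p => V (rho p) * (opG u p ^+ 2 / sqnorm (gradG rho p)))
  = (lebesgue_int (ballG rad) (fun p => W (rho p) * sqnorm (gradG u p))%R
     + (Q%:R - 1)%:E * lebesgue_int (ballG rad) (fun p =>
         (V (rho p) / rho p ^+ 2 - derive1 V (rho p) / rho p)
         * sqnorm (gradG u p))%R
     + lebesgue_int (ballG rad) (fun p =>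
         V (rho p) * sqnorm (gradG (fun q => drho u q / f (rho q)) p)
         * f (rho p) ^+ 2)%R)%E.
Proof.
have n0 : (0 < n)%N by apply: leq_trans hn.
rewrite {Q}hQ in hVW *.
have [phi [psi [theta [a [b [a0 brad uphi [dphi dpsi ctheta psi0 theta0]]]]]]] :=
  radial_profile hrad hu hur.
have gradu p : sqnorm (gradG u p) = 16 * psi (gauge p) ^+ 2 * horiz p * gauge p.
  have -> : u = fun q => phi (gauge q) by apply/funext.
  apply: sqnorm_gradG => [i|].
    exact: is_derive_comp_gauge_ex.
  exact: is_derive_comp_gauge_et.
have outside (h : R -> R) : (forall y, ~ (a <= y <= b) -> h y = 0) ->
    forall v : n.+1.-tuple (measurableTypeR R), ~ ballG rad (point v) ->
    h (gauge (point v)) * horiz (point v) = 0.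
  move=> h0 v vrad; rewrite h0 ?mul0r// => vab; apply: vrad.
  by have [_ [_]] := root4_interval0 a0 brad vab; rewrite /ballG/= rho_gauge.
have mB := @measurable_ballG R n rad.
have cts := density_continuity hVW a0 brad dpsi ctheta.
(* Each of the four integrals is moved to tuples with the same three obligations: its density is box
   bounded, it agrees with the integrand on the ball, and it vanishes outside. *)
rewrite (lebesgue_int_tuple (G := fun v =>
    density_op n V psi theta (gauge (point v)) * horiz (point v)) mB); last 3 first.
- apply: (box_bounded_density n _ (density_op0 n V psi0 theta0)).
  by move=> y /cts[].
- move=> v _; move: (point v) => p.
  rewrite (opG_comp_gauge uphi dphi (dpsi _)) rho_gauge /density_op.
  have [pab|pab] := pselect (a <= gauge p <= b); last first.
    (* This covers the origin, where the derivatives of rho are junk. *)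
    by rewrite psi0// theta0//; ring.
  have [p0 _] := root4_interval0 a0 brad pab.
  rewrite sqnorm_gradG_rho//.
  have r0 : root4 (gauge p) != 0 by rewrite gt_eqF// root4_gt0.
  (* On the axis x = 0 the denominator S/ρ² is 0, but so is L_G u; both sides are 0. *)
  have [h0|h0] := eqVneq (horiz p) 0; last by field; rewrite h0 r0.
  by rewrite h0; ring.
- exact: outside (density_op0 n V psi0 theta0).
rewrite (lebesgue_int_tuple (G := fun v =>
    density_W W psi (gauge (point v)) * horiz (point v)) mB); last 3 first.
- apply: (box_bounded_density n _ (density_W0 W psi0)).
  by move=> y /cts[].
- by move=> v _; rewrite gradu rho_gauge /density_W; ring.
- exact: outside (density_W0 W psi0).
rewrite (lebesgue_int_tuple (G := fun v =>
    density_V V psi (gauge (point v)) * horiz (point v)) mB); last 3 first.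
- apply: (box_bounded_density n _ (density_V0 V psi0)).
  by move=> y /cts[].
- by move=> v _; rewrite gradu rho_gauge /density_V; ring.
- exact: outside (density_V0 V psi0).
rewrite (lebesgue_int_tuple (G := fun v =>
    density_rem V f psi theta (gauge (point v)) * horiz (point v)) mB); last 3 first.
- apply: (box_bounded_density n _ (density_rem0 V f psi0 theta0)).
  by move=> y /cts[].
- move=> v _; rewrite rho_gauge /density_rem.
  (* [gradG] differentiates the quotient, so the equality is needed as one of functions, at the
     origin as well. *)
  have -> : (fun q => drho u q / f (rho q)) =
      fun q => radial_quotient f psi (gauge q).
    apply/funext => q.
    by rewrite (drho_comp_gauge uphi (dphi _)) rho_gauge.
  have D := is_derive_radial_quotient hVW a0 brad dpsi psi0 theta0 (gauge (point v)).
  rewrite (sqnorm_gradG (fun i => is_derive_comp_gauge_ex i D)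
    (is_derive_comp_gauge_et D)).
  by ring.
- exact: outside (density_rem0 V f psi0 theta0).
rewrite (integral_density_identity n0 hVW a0 brad dpsi ctheta psi0 theta0).
by rewrite natrD (_ : n%:R + 2 - 1 = n%:R + 1 :> R)//; ring.
Qed.
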